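(* Let $G$ be a finite group, let $R(G)$ be its real core, let $B_0$ be the principal $2$-block of $G$ and let $D$ be a defect group of $B_0$, i.e. a Sylow $2$-subgroup of $G$. If $|R(G)|$ is odd, then for every integer $n\ge 0$ $$\sum_{i=0}^{n}\mathrm{k}_{i,rv}(B_0)\le |\{y\in D/D^{(n+1)} : y \text{ is } N_G(D)/D^{(n+1)}\text{-real}\}|;$$ hence also $\mathrm{k}_{0,rv}(B_0)$ is at most the number of $N_G(D)/D'$-real elements of $D/D'$, $\mathrm{k}_{rv}(B_0)$ is at most the number of $N_G(D)$-real elements of $D$, and $\mathrm{k}_{rv}(B_0)$ is at most the number of $G$-real elements of $D$. In particular, the displayed inequality holds for all $n\ge 0$ whenever one of the following occurs: (a) the commutator subgroup $G'$ is $2$-nilpotent; (b) $G=O_{2',2,2'}(G)$ (in fact this is equivalent to $|R(G)|$ being odd); (c) $G$ is solvable and its Sylow $2$-subgroups are abelian. Moreover, one may replace $N_G(D)$ by $D$ in the displayed inequality: for every $n\ge 0$, $\sum_{i=0}^{n}\mathrm{k}_{i,rv}(B_0)$ is at most the number of $D/D^{(n+1)}$-real elements of $D/D^{(n+1)}$.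
   Context: Ordinary characters are complex characters. An element of $G$ is real if it is conjugate in $G$ to its inverse. The real core $R(G)$ is the subgroup of $G$ generated by all real elements of odd order. $\mathrm{k}_{rv}(B)$ is the number of real-valued irreducible ordinary characters in the $2$-block $B$ and $\mathrm{k}_{i,rv}(B)$ is the number of those of height $i$. $D^{(n)}$ is the $n$-th derived subgroup of $D$ (so $D^{(1)}=D'$). For a subgroup $H$ of a group, an element $x$ is called $H$-real if there is $h\in H$ with $h^{-1}xh=x^{-1}$. $O_{2',2,2'}(G)$ is the third term of the upper series: $O_{2'}(G)$ is the largest normal subgroup of odd order, $O_{2',2}(G)/O_{2'}(G)=O_2(G/O_{2'}(G))$, and $O_{2',2,2'}(G)/O_{2',2}(G)=O_{2'}(G/O_{2',2}(G))$. *)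

(* Defs.v *)
From mathcomp Require Import all_boot all_order all_fingroup all_algebra.
From mathcomp Require Import all_solvable all_field all_character.

Set Implicit Arguments.
Unset Strict Implicit.
Unset Printing Implicit Defensive.

Import GroupScope Order.TTheory GRing.Theory Num.Theory.
Local Open Scope ring_scope.

(* Ideals of the ring [Aint] of algebraic integers, which in the library is
   only a subring predicate on the field [algC]. *)
Definition Aint_ideal (J : {pred algC}) : Prop :=
  [/\ {subset J <= Aint}, 0 \in J,
      {in J &, forall x y, x + y \in J}
    & {in Aint & J, forall a x, a * x \in J}].

Definition Aint_maximal_ideal (M : {pred algC}) : Prop :=
  [/\ Aint_ideal M, 1 \notin M
    & forall J : {pred algC}, Aint_ideal J -> {subset M <= J} ->
        1 \notin J -> J =i M].

Section Characters.

Variables (gT : finGroupType) (G : {group gT}).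

(* When [M] is a maximal ideal of [Aint] containing the prime [p], two
   irreducible characters lie in the same [p]-block if and only if their
   central characters agree modulo [M]. *)
Definition char_block (M : {pred algC}) (i : Iirr G) : {set Iirr G} :=
  [set j | [forall k : 'I_#|classes G|,
              'omega_j['K_k] - 'omega_i['K_k] \in M]].

Definition principal_block (M : {pred algC}) : {set Iirr G} :=
  char_block M 0.

Definition char_deg (i : Iirr G) : nat := Num.truncn ('chi_i 1%g).

(* For a [p]-block [B], p ^ (a - block_defect p B) is the least [p]-part of
   the degree of a character in [B], where p ^ a is the [p]-part of [#|G|]. *)
Definition block_defect (p : nat) (B : {set Iirr G}) : nat :=
  \max_(i in B) (logn p #|G| - logn p (char_deg i)).

(* The height h is determined by chi(1)_p = p ^ (a - block_defect p B + h);
   the subtraction below is not truncated when [i \in B]. *)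
Definition char_height (p : nat) (B : {set Iirr G}) (i : Iirr G) : nat :=
  (logn p (char_deg i) + block_defect p B - logn p #|G|)%N.

Definition k_rv (B : {set Iirr G}) : nat :=
  #|[set i in B | cfReal 'chi_i]|.

Definition k_height_rv (p h : nat) (B : {set Iirr G}) : nat :=
  #|[set i in B | cfReal 'chi_i && (char_height p B i == h)]|.

End Characters.

Section Groups.

Variable gT : finGroupType.
Implicit Types (A H : {set gT}) (G : {group gT}) (x : gT).

Definition real_in H x : bool := [exists h in H, x ^ h == x^-1]%g.

Definition real_elts A H : {set gT} := [set x in A | real_in H x].

Definition real_core G : {group gT} :=
  <<[set x in G | odd #[x] && real_in G x]>>%G.

(* Existence of a normal p-complement. *)
Definition p_nilpotent (p : nat) (G : {group gT}) : bool :=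
  [exists K : {group gT}, (K <| G) && p^'.-Hall(G) K].

End Groups.

(* Main.v *)
(* A group with no nontrivial real element of odd order has a normal Sylow
   2-subgroup: if t is an involution then t * t ^ g is inverted by t, so its odd
   part is trivial, and Baer-Suzuki puts t in 'O_2(G). As real elements of odd
   order lift along odd quotients and 2-quotients, this gives the equivalence
   with 'O_{2^', 2, 2^'}(G) = G.

   Let N = 'O_2^'(G). Characters of the principal block are trivial on N. When
   D N is normal in G, a character of height at most n in that block restricts
   to D as a sum of irreducible characters of degree at most 2 ^ n, which are
   trivial on D^`(n.+1). So the real-valued ones are characters of
   L = G / (N D^`(n.+1)). The group L has at most as many real-valued irreducible
   characters as real elements, and these lie in its normal Sylow 2-subgroup,
   isomorphic to D / D^`(n.+1), where they are already inverted by a 2-element. *)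
Require Import Defs.
From mathcomp Require Import all_boot all_order all_fingroup all_algebra.
From mathcomp Require Import all_solvable all_field all_character.

Set Implicit Arguments.
Unset Strict Implicit.
Unset Printing Implicit Defensive.

Import GroupScope.

(** * Real elements: inverting 2-elements and lifting through quotients *)

(** Even powers of an inverting [h] centralise [x], so odd powers still invert it; raising [h] to
    the odd part of its order leaves a 2-element. *)
Lemma real_in_2elt (gT : finGroupType) (G : {group gT}) x :
  real_in G x -> exists2 t, t \in G /\ 2.-elt t & x ^ t = x^-1.
Proof.
case/exists_inP=> h Gh /eqP xh.
exists (h ^+ #[h]`_2^').
  split; first exact: groupX.
  by rewrite p_elt_exp.
have xh2 k : x ^ (h ^+ k.*2) = x.
  elim: k => [|k IH]; first by rewrite conjg1.
  by rewrite doubleS !expgSr !conjgM IH xh conjVg xh invgK.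
have oddm : odd #[h]`_2^' by rewrite odd_2'nat part_pnat.
by rewrite -[partn _ _]odd_double_half oddm add1n expgSr conjgM xh2.
Qed.

Lemma real_in_sub (gT : finGroupType) (A B : {set gT}) x :
  A \subset B -> real_in A x -> real_in B x.
Proof.
move/subsetP=> sAB /exists_inP[h Ah xh]; apply/exists_inP.
by exists h; first exact: sAB.
Qed.

Lemma real_in_morphim (aT rT : finGroupType) (D G : {group aT})
    (f : {morphism D >-> rT}) x :
  G \subset D -> x \in D -> real_in G x -> real_in (f @* G) (f x).
Proof.
move=> sGD Dx /exists_inP[h Gh /eqP xh]; apply/exists_inP; exists (f h).
  by rewrite mem_morphim // (subsetP sGD).
by rewrite -morphJ ?xh ?morphV // (subsetP sGD).
Qed.

(** An inverting 2-element [t] lies in [Q], hence so does [[~ x, t]], which equals the inverse of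
    [x ^+ 2]. The odd part of [#[x]] then divides 2. *)
Lemma real_in_normal_Sylow2 (gT : finGroupType) (G Q : {group gT}) x :
  Q <| G -> 2.-Sylow(G) Q -> x \in G -> real_in G x -> x \in Q /\ real_in Q x.
Proof.
move=> nsQG sylQ Gx /real_in_2elt[t [Gt t2] xt].
have Qt : t \in Q by rewrite (mem_normal_Hall sylQ).
split; last by apply/exists_inP; exists t => //; apply/eqP.
have Qx2 : x ^+ 2 \in Q.
  rewrite -groupV -expgVn expgS expg1 -{2}xt -commgEl commgEr groupMr //.
  by rewrite memJ_norm ?groupV // (subsetP (normal_norm nsQG)).
rewrite (mem_normal_Hall sylQ) // /p_elt -(partnC 2 (order_gt0 x)) pnatM.
rewrite part_pnat /=.
have := mem_p_elt (pHall_pgroup sylQ) Qx2; rewrite p_elt_exp.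
by move=> p2; apply: pnat_dvd p2 (pnat_id _).
Qed.

Lemma odd_order_quotient (gT : finGroupType) (N : {group gT}) x :
  x \in 'N(N) -> odd #|N| -> odd #[coset N x] -> odd #[x].
Proof.
move=> nNx oddN oddx.
have Nx: x ^+ #[coset N x] \in N.
  by apply: coset_idr; rewrite ?groupX // morphX // expg_order.
have: odd (#[coset N x] * #|N|)%N by rewrite oddM oddx.
rewrite !odd_2'nat; apply: pnat_dvd.
by rewrite order_dvdn expgM -order_dvdn order_dvdG.
Qed.

(* A 2-element h inverting u modulo N permutes the odd-size coset u by
   y |-> (y^-1) ^ h, a permutation of 2-power order, so it has a fixed point. *)
Lemma real_lift_odd (gT : finGroupType) (G N : {group gT}) (u : coset_of N) :
    N <| G -> odd #|N| -> u \in G / N -> odd #[u] -> real_in (G / N) u ->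
  exists2 x, x \in G & [/\ coset N x = u, odd #[x] & real_in G x].
Proof.
move=> /andP[sNG nNG] oddN /morphimP[x nNx Gx def_u] oddu.
case/real_in_2elt=> t [Gt t2] ut.
have [h Gh [def_t h2]]: exists2 h, h \in G & t = coset N h /\ 2.-elt h.
  case/morphimP: Gt => h nNh Gh def_t; exists h.`_2; first exact: groupX.
  split; last exact: p_elt_constt.
  by rewrite morph_constt // -def_t constt_p_elt.
have nNh := subsetP nNG h Gh.
pose f y := (y^-1) ^ h.
have inj_f : injective f by apply: inj_comp (conjg_inj h) invg_inj.
pose s : {perm gT} := perm inj_f.
have s2E k y : (s ^+ k.*2) y = y ^ (h ^+ k.*2).
  elim: k => [|k IH]; first by rewrite perm1 conjg1.
  by rewrite doubleS !expgSr !permM IH !permE /f !conjgM !conjVg invgK.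
(* Even powers of [s] are conjugations by powers of [h], so the order of [s] divides twice that of
   [h]. *)
have s2 : 2.-group <[s]>.
  have: 2.-nat (#[h].*2) by rewrite -muln2 pnatM [2.-nat _]h2.
  apply: pnat_dvd; rewrite order_dvdn; apply/eqP/permP=> y.
  by rewrite s2E perm1 -mul2n mulnC expgM expg_order expg1n conjg1.
have fS y : y \in N :* x -> s y \in N :* x.
  rewrite permE /f => Ny; have nNy : y \in 'N(N).
    by apply: subsetP Ny; rewrite mul_subG ?normG ?sub1set.
  have /rcoset_kercosetP eq_yx := Ny; apply/rcoset_kercosetP=> //.
    by rewrite groupJ ?groupV.
  rewrite morphJ ?groupV // morphV //= eq_yx // -def_u conjVg -def_t.
  by rewrite ut invgK.
have: #|N :* x| = #|'Fix_(N :* x | 'P)(<[s]>)| %[mod 2].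
  apply: (pgroup_fix_mod s2); rewrite cycle_subG; apply/astabsP=> /= y.
  rewrite apermE; apply/idP/idP; last exact: fS.
  have Ey : y = iter #[s].-1 s (s y).
    by rewrite -iterSr prednK // -permX expg_order perm1.
  by move=> sy; rewrite Ey; elim: (_.-1) => [|k IH] //=; apply: fS.
rewrite card_rcoset !modn2 oddN; case: (set_0Vmem 'Fix_(N :* x | 'P)(<[s]>)).
  by move->; rewrite cards0.
case=> y /setIP[Ny]; rewrite afix_cycle => /afix1P /= fy _.
have nNy : y \in 'N(N).
  by apply: subsetP Ny; rewrite mul_subG ?normG ?sub1set.
have eq_yx : coset N y = coset N x by apply/rcoset_kercosetP.
exists y.
  by apply: subsetP Ny; rewrite mul_subG ?sub1set.
split; first by rewrite eq_yx.
  by apply: odd_order_quotient oddN _; rewrite // eq_yx -def_u.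
apply/exists_inP; exists h => //; move: fy.
by rewrite apermE permE /f conjVg => fy; rewrite -{2}fy invgK.
Qed.

(** The odd part [x] of a preimage still maps to [u]. Both [<[x]> :^ h] and [<[x]>] complement [N]
    in [N * <[x]>], so by Schur-Zassenhaus some [n] in [N] corrects [h] to normalise [<[x]>]. Then
    [x] times its conjugate lies in both [N] and [<[x]>], which meet trivially. *)
Lemma real_lift_2group (gT : finGroupType) (G N : {group gT}) (u : coset_of N) :
    N <| G -> 2.-group N -> u \in G / N -> odd #[u] -> real_in (G / N) u ->
  exists2 x, x \in G & [/\ coset N x = u, odd #[x] & real_in G x].
Proof.
move=> /andP[sNG nNG] N2 /morphimP[x' nNx' Gx' def_u] oddu.
case/exists_inP=> t /morphimP[h nNh Gh ->{t}] /eqP ut.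
pose x := x'.`_2^'; have Gx: x \in G by apply: groupX.
have nNx := subsetP nNG x Gx.
have {}def_u : coset N x = u.
  by rewrite morph_constt // -def_u constt_p_elt // /p_elt -odd_2'nat.
have oddx : odd #[x] by rewrite odd_2'nat -/(p_elt _ _) p_elt_constt.
exists x => //; split=> //.
have sXh : <[x]> :^ h \subset N * <[x]>.
  have nNX: <[x]> \subset 'N(N) by rewrite cycle_subG.
  rewrite -cycleJ -(norm_joinEr nNX) cycle_subG /= norm_joinEr //.
  suffices: x ^ h \in N :* x^-1.
    by apply: subsetP; rewrite mulgS ?sub1set ?groupV ?cycle_id.
  apply/rcoset_kercosetP; rewrite ?groupJ ?groupV //.
  by rewrite morphJ // morphV //= def_u.
have coNx : coprime #|N| #|<[x]>|.
  by apply: pnat_coprime N2 _; rewrite -odd_2'nat.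
have [||||n Nn defXh] := SchurZassenhaus_trans_sol _ _ sXh;
  rewrite ?cycle_subG ?cardJg //.
  exact: pgroup_sol N2.
have nNn := subsetP (normG N) n Nn.
apply/exists_inP; exists (h * n^-1).
  by rewrite groupM ?groupV // (subsetP sNG).
have Xy: x ^ (h * n^-1) \in <[x]>.
  by rewrite conjgM -mem_conjg -defXh memJ_conjg cycle_id.
rewrite eq_sym eq_invg_mul -in_set1 -[[set 1]]/(1%g : {set gT}) -(coprime_TIg coNx).
rewrite inE andbC groupM ?cycle_id //=.
have nNhn : h * n^-1 \in 'N(N) by rewrite groupM ?groupV.
have nNxy : x ^ (h * n^-1) \in 'N(N) by apply: groupJ.
apply: coset_idr; first exact: groupM.
rewrite morphM //= morphJ //= morphM ?groupV //= morphV //= (coset_id Nn).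
by rewrite invg1 mulg1 def_u ut mulgV.
Qed.

(** * Real elements of odd order and the quotient by ['O_2(G)] *)

(** The dihedral argument: [t] inverts [t * s], so [<[t * s]>] extended by [<[t]>] is a 2-group
    containing both generators. *)
Lemma pgroup2_gen_involutions (gT : finGroupType) (t s : gT) :
  t ^+ 2 = 1 -> s ^+ 2 = 1 -> 2.-elt (t * s) -> 2.-group <<[set t; s]>>.
Proof.
move=> t2 s2 ts2.
have tV : t^-1 = t by apply/eqP; rewrite eq_invg_mul -t2.
have sV : s^-1 = s by apply/eqP; rewrite eq_invg_mul -s2.
have nt : <[t]> \subset 'N(<[t * s]>).
  rewrite cycle_subG; apply/normP; rewrite -cycleJ conjgE {1}tV !mulgA.
  by rewrite [t * t]t2 mul1g -{1}sV -{1}tV -invMg cycleV.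
have: 2.-group (<[t * s]> <*> <[t]>).
  rewrite norm_joinEr // pgroupM [2.-group _]ts2 /pgroup.
  by apply: pnat_dvd (pnat_id (isT : prime 2)); rewrite order_dvdn t2.
apply: pgroupS; rewrite gen_subG subUset !sub1set.
have Jt : t \in <[t * s]> <*> <[t]> by rewrite mem_gen // inE cycle_id orbT.
by rewrite Jt -(groupMl _ Jt) mem_gen // inE cycle_id.
Qed.

Lemma real_mul_involutions (gT : finGroupType) (t s : gT) (A : {set gT}) :
  t \in A -> t ^+ 2 = 1 -> s ^+ 2 = 1 -> real_in A (t * s).
Proof.
move=> At t2 s2; apply/exists_inP; exists t => //.
have tV : t^-1 = t by apply/eqP; rewrite eq_invg_mul -t2.
have sV : s^-1 = s by apply/eqP; rewrite eq_invg_mul -s2.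
by rewrite conjgE !mulgA mulVg mul1g invMg tV sV.
Qed.

Lemma real_inX (gT : finGroupType) (A : {set gT}) x k :
  real_in A x -> real_in A (x ^+ k).
Proof.
case/exists_inP=> h Ah /eqP xh; apply/exists_inP; exists h => //.
by rewrite conjXg xh expVgn.
Qed.

Lemma odd_quotient_pcore2 (gT : finGroupType) (G : {group gT}) :
    (forall x, x \in G -> odd #[x] -> real_in G x -> x = 1) ->
  odd #|G / 'O_2(G)|.
Proof.
move=> G_no_real; apply: contraT => evenQ; pose Q := (G / 'O_2(G))%G.
have [|t Qt t2] := @Cauchy _ 2 Q isT; first by rewrite dvdn2.
have: t \in 'O_2(Q).
  have {}t2 : t ^+ 2 = 1 by apply/eqP; rewrite -order_dvdn t2.
  apply: Baer_Suzuki => // g Qg.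
  have tg2 : (t ^ g) ^+ 2 = 1 by rewrite -conjXg t2 conj1g.
  apply: pgroup2_gen_involutions => //.
  set u := t * t ^ g.
  (* The assumption concerns [G], not its quotient: the odd part of [u] is real, so it lifts to a
     real element of odd order in [G], which is trivial. *)
  have Qu : u.`_2^' \in Q by apply: groupX; rewrite groupM ?groupJ.
  have oddu : odd #[u.`_2^'] by rewrite odd_2'nat -/(p_elt _ _) p_elt_constt.
  have [|x Gx [def_u oddx realx]] :=
    real_lift_2group (pcore_normal 2 G) (pcore_pgroup 2 G) Qu oddu.
    exact/real_inX/real_mul_involutions.
  rewrite (G_no_real x) // morph1 in def_u.
  by rewrite -(consttC 2 u) -def_u mulg1 p_elt_constt.
by rewrite trivg_pcore_quotient => /set1P t1; rewrite t1 order1 in t2.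
Qed.

Lemma odd_quotient_pcore2_real (gT : finGroupType) (G : {group gT}) x :
  odd #|G / 'O_2(G)| -> x \in G -> odd #[x] -> real_in G x -> x = 1.
Proof.
move=> oddW Gx oddx realx.
have sylO : 2.-Sylow(G) 'O_2(G).
  rewrite /pHall pcore_sub pcore_pgroup -card_quotient ?gFnorm //=.
  by rewrite -odd_2'nat.
have [] := real_in_normal_Sylow2 (pcore_normal 2 G) sylO Gx realx.
rewrite (mem_Hall_pcore sylO) // => x2 _.
by apply/eqP; rewrite -order_eq1; apply/eqP/(pnat_1 x2); rewrite -odd_2'nat.
Qed.

(** * Odd real core and the upper series *)

(** The generators are closed under conjugation, so a real core of odd order is normal and lies in
    ['O_2^'(G)], itself of odd order. *)
Lemma odd_real_coreP (gT : finGroupType) (G : {group gT}) :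
  odd #|real_core G| <->
  (forall x, x \in G -> odd #[x] -> real_in G x -> x \in 'O_2^'(G)).
Proof.
have sRG : real_core G \subset G.
  by rewrite gen_subG; apply/subsetP=> x; rewrite inE => /andP[].
split=> [oddR x Gx oddx realx | realO].
  have nsRG : real_core G <| G.
    rewrite /(_ <| _) sRG norms_gen //; apply/subsetP=> g Gg; rewrite inE.
    apply/subsetP=> _ /imsetP[y /setIdP[Gy /andP[oddy realy]] ->].
    have [h Gh /eqP yh] := exists_inP realy.
    rewrite inE groupJ // orderJ oddy; apply/exists_inP.
    exists (h ^ g); first exact: groupJ.
    by rewrite -conjJg yh conjVg.
  have /subsetP-> // : real_core G \subset 'O_2^'(G).
    by rewrite pcore_max // /pgroup -odd_2'nat.
  by rewrite mem_gen // inE Gx oddx.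
rewrite odd_2'nat; apply: pgroupS (pcore_pgroup 2^' G).
rewrite gen_subG; apply/subsetP=> x /setIdP[Gx /andP[oddx realx]].
exact: realO.
Qed.

Lemma odd_real_core_pcore (gT : finGroupType) (G : {group gT}) :
  odd #|real_core G| <-> odd #|G / 'O_2^'(G) / 'O_2(G / 'O_2^'(G))|.
Proof.
have oddN: odd #|'O_2^'(G)| by rewrite odd_2'nat; apply: pcore_pgroup.
split=> [/odd_real_coreP realO | oddW].
  apply: odd_quotient_pcore2 => u Qu oddu realu.
  have [x Gx [<- oddx realx]] :=
    real_lift_odd (pcore_normal _ _) oddN Qu oddu realu.
  by rewrite coset_id // realO.
apply/odd_real_coreP=> x Gx oddx realx.
have nNx : x \in 'N('O_2^'(G)) by apply: subsetP Gx; apply: gFnorm.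
apply: coset_idr => //; apply: (odd_quotient_pcore2_real oddW).
- exact: mem_quotient.
- by apply: dvdn_odd oddx; apply: morph_order.
- exact: real_in_morphim (gFnorm _ _) _ _.
Qed.

(** The iterated quotient has the order of [G / 'O_{2^', 2}(G)], and the third term of the series is
    the whole of [G] exactly when this quotient is its own [2^']-core. *)
Lemma pseries2_odd_quotient (gT : finGroupType) (G : {group gT}) :
  'O_{2^', 2, 2^'}(G) = G <-> odd #|G / 'O_2^'(G) / 'O_2(G / 'O_2^'(G))|.
Proof.
have eq_card : #|G / 'O_2^'(G) / 'O_2(G / 'O_2^'(G))| = #|G / 'O_{2^', 2}(G)|.
  have /= E := quotient_pseries2 2^' 2 G.
  rewrite !card_quotient ?gFnorm //= -E.
  rewrite index_quotient_eq ?gFnorm ?pseries_sub // (setIidPr (pcore_sub _ _)).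
  by rewrite -pseries1 (pseries_sub_catl [:: _] [:: _]).
rewrite eq_card odd_2'nat.
have /= E := quotient_pseries [:: 2^' : nat_pred; 2 : nat_pred] 2^' G.
split=> [defG | oddW]; first by move: E; rewrite defG => ->; apply: pcore_pgroup.
have nOG : G \subset 'N('O_{2^', 2}(G)) := gFnorm _ _.
apply/eqP; rewrite eqEsubset pseries_sub /= -(quotientSGK nOG).
  by rewrite E pcore_pgroup_id.
exact: (pseries_sub_catl [:: _; _] [:: _]).
Qed.

(** * Sufficient conditions for an odd real core *)

(** If [h] inverts [x], then [[~ x, h]] is the inverse of [x ^+ 2]; for odd order this puts [x] in
    the derived subgroup, hence in its normal 2-complement. *)
Lemma p_nilpotent_der_odd_real_core (gT : finGroupType) (G : {group gT}) :
  p_nilpotent 2 G^`(1)%G -> odd #|real_core G|.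
Proof.
case/existsP=> K /andP[nsKG' hallK]; rewrite odd_2'nat.
apply: pgroupS (pHall_pgroup hallK).
rewrite gen_subG; apply/subsetP=> x /setIdP[Gx /andP[oddx realx]].
have [h Gh /eqP xh] := exists_inP realx.
have G'x2 : x ^+ 2 \in G^`(1).
  by rewrite -groupV -expVgn expgS expg1 -{2}xh -commgEl mem_commg.
have G'x : x \in G^`(1).
  have: generator <[x]> (x ^+ 2) by rewrite generator_coprime coprimen2.
  by move/eqP=> defX; rewrite -cycle_subG defX cycle_subG.
by rewrite (mem_normal_Hall hallK) // /p_elt -odd_2'nat.
Qed.

(** Descent along the derived series of the centraliser [C]: if [C^(k+1)] lies in ['F(G)], it is
    central in [C^(k)], so [C^(k)] is nilpotent and normal in [G], hence inside ['F(G)]. *)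
Lemma cent_sub_Fitting (gT : finGroupType) (G : {group gT}) :
  solvable G -> 'C_G('F(G)) \subset 'F(G).
Proof.
move=> solG; pose C := 'C_G('F(G))%G.
have nsCG : C <| G.
  by rewrite /(_ <| _) subsetIl normsI ?normG ?norms_cent ?gFnorm.
have step k : C^`(k.+1) \subset 'F(G) -> C^`(k) \subset 'F(G).
  move=> sCF; apply: Fitting_max; first exact: gFnormal_trans.
  rewrite -quotient_center_nil abelian_nil // sub_der1_abelian // subsetI der_sub.
  apply: subset_trans sCF _; rewrite centsC; apply: subset_trans (der_sub k C) _.
  exact: subsetIr.
have /derivedP[n sCn1] : solvable C by apply: solvableS solG; apply: subsetIl.
suffices: forall m, C^`(m) \subset 'F(G) -> C \subset 'F(G).
  by move/(_ n); apply; rewrite sCn1 sub1G.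
by elim=> // m IH /step.
Qed.

(** In [H] the Fitting subgroup is ['O_2(H)]. The abelian Sylow subgroup contains it, so centralises
    it, and therefore lies in it. *)
Lemma abelian_Sylow2_odd_quotient (gT : finGroupType) (G D : {group gT}) :
  solvable G -> 2.-Sylow(G) D -> abelian D ->
  odd #|G / 'O_2^'(G) / 'O_2(G / 'O_2^'(G))|.
Proof.
move=> solG sylD abD; set H := (G / 'O_2^'(G))%G.
have sylP : 2.-Sylow(H) (D / 'O_2^'(G)).
  by apply: quotient_pHall (sylD); 
    rewrite (subset_trans (pHall_sub sylD)) ?gFnorm.
have sPO : D / 'O_2^'(G) \subset 'O_2(H).
  rewrite -(Fitting_eq_pcore (trivg_pcore_quotient _ _)).
  apply: subset_trans (cent_sub_Fitting (quotient_sol _ solG)).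
  rewrite subsetI (pHall_sub sylP) centsC.
  rewrite (Fitting_eq_pcore (trivg_pcore_quotient _ _)).
  apply: subset_trans (pcore_sub_Hall sylP) _.
  exact: quotient_abelian.
rewrite odd_2'nat card_quotient ?gFnorm //.
by have /and3P[_ _] := sylP; apply: pnat_dvd; apply: indexgS.
Qed.

(** * Real-valued characters and real elements *)

Section CharacterTheory.

Import Order.TTheory GRing.Theory Num.Theory.
Local Open Scope ring_scope.

(* Summing '[chi, chi^*] over all irreducible chi with the second orthogonality
   relation gives the average over G of #|'C_G[x]| on the real elements x. *)
Lemma card_cfReal_leq (gT : finGroupType) (G : {group gT}) :
  (#|[set i : Iirr G | cfReal 'chi_i]| <= #|real_elts G G|)%N.
Proof.
have cfRealE (i : Iirr G) :
    (cfReal 'chi_i)%:R = '['chi_i, ('chi_i)^*%CF] :> algC.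
  rewrite -conjC_IirrE cfdot_irr -(inj_eq irr_inj) conjC_IirrE eq_sym.
  by congr (_%:R).
rewrite -leC_nat -sum1_card natr_sum.
have -> : \sum_(i in [set i : Iirr G | cfReal 'chi_i]) 1%:R
   = #|G|%:R^-1 * \sum_(x in G) #|'C_G[x]|%:R *+ (x \in x^-1 ^: G)%g :> algC.
  transitivity (\sum_(i : Iirr G) '['chi_i, ('chi_i)^*%CF]).
    rewrite big_mkcond; apply: eq_bigr => i _; rewrite inE -cfRealE.
    by case: cfReal.
  under eq_bigr => i _ do rewrite cfdotE.
  rewrite -mulr_sumr exchange_big /=; congr (_ * _).
  apply: eq_bigr => x Gx; rewrite -second_orthogonality_relation ?groupV //.
  apply: eq_bigr => i _; rewrite cfunE char_inv ?irr_char //.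
(* The average is the number of real classes; bounding each centraliser order by [#|G|] leaves the
   number of real elements. *)
rewrite ler_pdivrMl ?gt0CG // mulr_natr -sumr_const.
rewrite big_mkcond [leRHS]big_mkcond /=.
apply: ler_sum => x _; rewrite inE; case: (x \in G) => //=.
have [/imsetP[g Gg def_x]|_] := boolP (x \in _); last first.
  by rewrite mulr0n; case: ifP.
have -> : real_in G x.
  by apply/exists_inP; exists g^-1%g; rewrite ?groupV // {1}def_x conjgK.
by rewrite mulr1n leC_nat subset_leq_card ?subsetIl.
Qed.

Lemma char_degE (gT : finGroupType) (G : {group gT}) (i : Iirr G) :
  'chi_i 1%g = (char_deg i)%:R.
Proof. by rewrite truncnK ?Cnat_irr1. Qed.

Lemma char_deg_gt0 (gT : finGroupType) (G : {group gT}) (i : Iirr G) :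
  (0 < char_deg i)%N.
Proof. by rewrite -ltC_nat -char_degE irr1_gt0. Qed.

Lemma dvdn_char_deg (gT : finGroupType) (G : {group gT}) (i : Iirr G) :
  (char_deg i %| #|G|)%N.
Proof. by have := dvd_irr1_cardG i; rewrite char_degE dvdC_nat. Qed.

Lemma char_deg_lin (gT : finGroupType) (G : {group gT}) (i : Iirr G) :
  ('chi_i \is a linear_char) = (char_deg i == 1)%N.
Proof. by rewrite qualifE /= irr_char char_degE -eqC_nat. Qed.

Lemma char_deg_Res (gT : finGroupType) (G H : {group gT})
    (i : Iirr G) (j : Iirr H) :
  H <| G -> j \in irr_constt ('Res[H] 'chi_i) -> (char_deg j %| char_deg i)%N.
Proof.
move=> nsHG /(dvdn_constt_Res1_irr1 nsHG)[k].
rewrite !char_degE -natrM => /eqP; rewrite eqC_nat => /eqP->.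
exact: dvdn_mull.
Qed.

Lemma pgroup_char_degE (gT : finGroupType) (p : nat) (P : {group gT})
    (i : Iirr P) :
  p.-group P -> {e | char_deg i = (p ^ e)%N}.
Proof. by move=> pP; apply/p_natP/(pnat_dvd (dvdn_char_deg i) pP). Qed.

(* If 'chi_i stayed irreducible on P', then 1 would be the only linear
   constituent of 'chi_i * ('chi_i)^*, whose degree would be 1 mod p. *)
Lemma pgroup_Res_der1 (gT : finGroupType) (p : nat) (P : {group gT})
    (i : Iirr P) (j : Iirr P^`(1)%G) :
    p.-group P -> 'chi_i \isn't a linear_char ->
  j \in irr_constt ('Res[P^`(1)] 'chi_i) -> (char_deg j < char_deg i)%N.
Proof.
move=> pP nonlin_i Rj; set H := (P^`(1))%G in j Rj *.
have sHP : H \subset P := der_sub 1 P.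
have p_dvd k : 'chi[P]_k \isn't a linear_char -> (p %| 'chi_k 1%g)%C.
  rewrite char_deg_lin char_degE dvdC_nat.
  have [[|e] ->] := pgroup_char_degE k pP; first by rewrite expn0.
  by rewrite expnS dvdn_mulr.
have nsHP : H <| P := der_normal 1 P.
have le_deg : (char_deg j <= char_deg i)%N.
  by rewrite dvdn_leq ?char_deg_gt0 ?(char_deg_Res nsHP).
rewrite ltn_neqAle le_deg andbT; apply/eqP=> eq_deg.
have NRi : 'Res[H] 'chi_i \is a character by rewrite cfRes_char ?irr_char.
have ResE : 'Res[H] 'chi_i = 'chi_j.
  have /constt_charP[] // := Rj => xi Nxi def_R.
  have /eqP := congr1 (fun phi : 'CF(H) => phi 1%g) def_R.
  rewrite cfunE cfResE // !char_degE eq_deg -{1}[_%:R]addr0.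
  rewrite (can_eq (addKr _)) eq_sym.
  by rewrite char1_eq0 // => /eqP xi0; rewrite def_R xi0 addr0.
set psi := 'chi_i * ('chi_i)^*%CF.
have Npsi : psi \is a character.
  by rewrite rpredM ?irr_char // cfConjC_char irr_char.
pose c k := '[psi, 'chi_k].
have Nc k : c k \in Num.nat by apply: Cnat_cfdot_char_irr.
have c0 : c 0 = 1.
  rewrite /c irr0; transitivity '['chi_i]; last by rewrite cfdot_irr eqxx.
  rewrite !cfdotE; congr (_ * _).
  by apply: eq_bigr => x Px; rewrite !cfunE cfun1E Px conjC1 mulr1.
(* Linear characters restrict to 1 on [H], so each contributes its multiplicity to ['['Res[H] psi,
   1]], which is the norm of ['chi_j]. *)
have sum_c : \sum_(k | 'chi[P]_k \is a linear_char) c k <= 1.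
  have <- : '['Res[H] psi, 1] = 1.
    transitivity '['chi_j]; last by rewrite cfdot_irr eqxx.
    rewrite -ResE !cfdotE; congr (_ * _).
    by apply: eq_bigr => x Hx; rewrite !cfResE // !cfunE cfun1E Hx conjC1 mulr1.
  have -> : psi = \sum_k c k *: 'chi_k by apply: cfun_sum_cfdot.
  rewrite raddf_sum cfdot_suml.
  rewrite [leRHS](bigID (fun k => 'chi[P]_k \is a linear_char)) /=.
  rewrite -[leLHS]addr0 lerD ?sumr_ge0 // => [|k _].
    apply: ler_sum => k lin_k; rewrite linearZ cfdotZl /=.
    have -> : 'Res[H] 'chi_k = 1.
      apply/cfun_inP=> x Hx; rewrite cfResE // cfun1E Hx.
      by rewrite cfker1 ?lin_char1 // (subsetP (lin_char_der1 lin_k)).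
    by rewrite cfnorm1 mulr1.
  rewrite linearZ cfdotZl; apply: mulr_ge0; apply: natr_ge0; first exact: Nc.
  by rewrite Cnat_cfdot_char ?cfRes_char ?irr_char ?cfun1_char.
have lin0 : 'chi[P]_0 \is a linear_char by rewrite irr0 cfun1_lin_char.
have sum_c0 : \sum_(k | ('chi[P]_k \is a linear_char) && (k != 0)) c k = 0.
  apply: le_anti; rewrite sumr_ge0 ?andbT => [|k _]; last exact: natr_ge0.
  by move: sum_c; rewrite (bigD1 0) //= c0 gerDl.
have c_lin k : 'chi[P]_k \is a linear_char -> k != 0 -> c k = 0.
  move=> lin_k nz_k; apply/eqP; move/eqP: sum_c0.
  rewrite psumr_eq0 => [|l _]; last exact: natr_ge0.
  by move/allP/(_ k); rewrite mem_index_enum lin_k nz_k => /(_ isT).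
pose S := \sum_(k | 'chi[P]_k \isn't a linear_char) c k * 'chi_k 1%g.
have psi1 : psi 1%g = 1 + S.
  have {1}-> : psi = \sum_k c k *: 'chi_k by apply: cfun_sum_cfdot.
  rewrite sum_cfunE (bigID (fun k => 'chi[P]_k \is a linear_char)) /=.
  congr (_ + _); last by apply: eq_bigr => k _; rewrite cfunE.
  rewrite (bigD1 0) //= big1 ?addr0 => [|k /andP[lin_k nz_k]].
    by rewrite cfunE c0 irr0 cfun11 mulr1.
  by rewrite cfunE c_lin ?mul0r.
have one_eq : psi 1%g - S = 1 by rewrite psi1 addrK.
have : (p %| 1)%C.
  rewrite -[X in (_ %| X)%C]one_eq rpredB ?rpred_sum // => [|k nonlin_k].
    rewrite cfunE dvdC_mulr ?p_dvd // intr_nat // Cnat_char1 //.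
    by rewrite cfConjC_char irr_char.
  by rewrite dvdC_mull ?p_dvd ?intr_nat.
(* With [p = 1] the degree [p ^ e] is 1, contradicting nonlinearity. *)
rewrite (dvdC_nat p 1) dvdn1 => /eqP p1; move: nonlin_i.
have [e] := pgroup_char_degE i pP.
by rewrite char_deg_lin p1 exp1n => ->.
Qed.

Lemma dergSr (gT : finGroupType) n (A : {set gT}) :
  (A^`(n.+1) = A^`(1)^`(n))%g.
Proof. by elim: n => // n IHn; rewrite !(dergSn n.+1) IHn. Qed.

(** Induction on [n]: a nonlinear character restricts to the derived subgroup with constituents of
    strictly smaller p-exponent, and [dergSr] turns one derivation of [P] into a shift of the
    index. *)
Lemma pgroup_der_cfker (gT : finGroupType) (p n : nat) (P : {group gT})
    (i : Iirr P) :
  prime p -> p.-group P -> (logn p (char_deg i) <= n)%N ->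
  P^`(n.+1)%g \subset cfker 'chi_i.
Proof.
move=> p_pr; elim: n => [|n IHn] in gT P i * => pP le_n.
  have [e deg_i] := pgroup_char_degE i pP.
  rewrite lin_char_der1 // char_deg_lin deg_i.
  by move: le_n; rewrite deg_i pfactorK // leqn0 => /eqP->.
have [lin_i | nonlin_i] := boolP ('chi_i \is a linear_char).
  by apply: subset_trans (lin_char_der1 lin_i); rewrite dergSr der_sub.
have sHP := der_sub 1 P.
have pH : p.-group P^`(1)%g := pgroupS sHP pP.
have sKH : (P^`(n.+2) \subset P^`(1))%g by rewrite dergSr der_sub.
have sKR : P^`(n.+2)%g \subset cfker ('Res[P^`(1)%g] 'chi_i).
  rewrite cfkerE ?cfRes_char ?irr_char // subsetI sKH; apply/bigcapsP=> j Rj.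
  rewrite dergSr IHn // -ltnS; apply: leq_trans le_n.
  have [[e def_i] [f def_j]] := (pgroup_char_degE i pP, pgroup_char_degE j pH).
  have := pgroup_Res_der1 pP nonlin_i Rj.
  by rewrite def_i def_j !pfactorK // ltn_exp2l ?prime_gt1.
apply/subsetP=> x Kx; have Hx := subsetP sKH x Kx.
rewrite cfkerEirr inE -!(cfResE _ sHP) ?group1 //.
by rewrite cfker1 // (subsetP sKR).
Qed.

(** By Clifford theory, constituents on [P] have degrees dividing that of ['chi_i], which reduces
    the claim to p-groups. *)
Lemma normal_pgroup_der_cfker (gT : finGroupType) (p n : nat) (G P : {group gT})
    (i : Iirr G) :
  prime p -> p.-group P -> P <| G -> (logn p (char_deg i) <= n)%N ->
  P^`(n.+1)%g \subset cfker 'chi_i.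
Proof.
move=> p_pr pP nsPG le_n; have sPG := normal_sub nsPG.
have sKP : (P^`(n.+1) \subset P)%g := der_sub _ _.
have sKR : P^`(n.+1)%g \subset cfker ('Res[P] 'chi_i).
  rewrite cfkerE ?cfRes_char ?irr_char // subsetI sKP; apply/bigcapsP=> j Rj.
  apply: pgroup_der_cfker pP _ => //; apply: leq_trans le_n.
  by rewrite dvdn_leq_log ?char_deg_gt0 ?(char_deg_Res nsPG).
apply/subsetP=> x Kx; have Px := subsetP sKP x Kx.
rewrite cfkerEirr inE -!(cfResE _ sPG) ?group1 //.
by rewrite cfker1 // (subsetP sKR).
Qed.

(** * Kernels and heights in the principal block *)

Lemma Aint_maximal_ideal_coprime (M : {pred algC}) (p n : nat) :
  Aint_maximal_ideal M -> p%:R \in M -> n%:R \in M -> ~~ coprime p n.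
Proof.
case=> [[_ M0 MD MM] M1 _] Mp Mn; apply: contra M1 => co_pn.
have [p0 | p_gt0] := posnP p.
  by move: co_pn Mn; rewrite p0 /coprime gcd0n => /eqP->.
have [u v def_u _] := egcdnP n p_gt0; rewrite (eqP co_pn) in def_u.
have -> : 1 = u%:R * p%:R + (- v%:R) * n%:R :> algC.
  by rewrite -natrM def_u natrD natrM mulNr addrAC subrr add0r.
by apply: MD; apply: MM; rewrite // ?rpredN rpred_nat.
Qed.

(** If the trivial character were no constituent on [N], the values of ['chi_i] would sum to 0 over
    [N]. Summing the differences of central characters over the classes inside [N] would then give
    [- #|N|%:R], putting [#|N|] in [M] together with [p], although they are coprime. *)
Lemma principal_block_cfker (gT : finGroupType) (G : {group gT})
    (M : {pred algC}) (p : nat) (i : Iirr G) :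
    prime p -> Aint_maximal_ideal M -> p%:R \in M ->
    i \in principal_block G M ->
  'O_p^'(G)%g \subset cfker 'chi_i.
Proof.
move=> p_pr maxM Mp; rewrite inE => /forallP B0i; set N := 'O_p^'(G)%G.
have nsNG : N <| G := pcore_normal _ _; have sNG := normal_sub nsNG.
have [[_ M0 MD MM] _ _] := maxM.
apply/(constt0_Res_cfker nsNG); rewrite irr_consttE irr0; apply/eqP=> Res0.
have sumN0 : \sum_(x in N) 'chi_i x = 0.
  move/eqP: Res0; rewrite cfdotE mulf_eq0 invr_eq0 (negPf (neq0CG _)) /=.
  move/eqP=> S0; rewrite -[RHS]S0.
  by apply: eq_bigr => x Nx; rewrite cfResE // cfun1E Nx conjC1 mulr1.
(* Extension by zero outside [N] gives a class function on [G], so the sum splits over the classes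
   of [G]. *)
pose F x := ('chi_i x / 'chi_i 1%g - 1) *+ (x \in N).
have sumF : \sum_(x in G) F x = - #|N|%:R.
  transitivity (\sum_(x in N) ('chi_i x / 'chi_i 1%g - 1)).
    rewrite (big_setID N) /= (setIidPr sNG) [X in _ + X]big1 ?addr0 => [|x].
      by apply: eq_bigr => x Nx; rewrite /F Nx.
    by rewrite /F inE => /andP[/negPf->].
  by rewrite big_split /= -mulr_suml sumN0 mul0r add0r sumrN sumr_const.
have Mn : #|N|%:R \in M.
  rewrite -[_%:R]opprK -sumF -mulN1r; apply: MM; first by rewrite rpredN rpred1.
  rewrite sum_by_classes => [|x y Gx Gy]; last first.
    by rewrite /F cfunJ // memJ_norm // (subsetP (normal_norm nsNG)).
  elim/big_ind: _ => // xG clG; rewrite /F.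
  case: (_ \in N); last by rewrite mulr0n mulr0.
  have := B0i (enum_rank_in clG xG); set k := enum_rank_in _ _.
  have k_x : repr xG \in enum_val k.
    by rewrite enum_rankK_in // (mem_repr_classes clG).
  have [Gx defxG] := repr_classesP clG.
  rewrite !(gring_mode_class_sum_eq _ k_x) irr0 !cfun1E Gx group1.
  by rewrite divr1 mulr1n -defxG mulrBr mulr1 mulrA.
have := Aint_maximal_ideal_coprime maxM Mp Mn.
by rewrite prime_coprime // -p'natE // => /negP[]; apply: pcore_pgroup.
Qed.

(** The trivial character has degree 1 and attains the full defect. *)
Lemma principal_block_height (gT : finGroupType) (G : {group gT})
    (M : {pred algC}) (p : nat) (i : Iirr G) :
  Aint_maximal_ideal M ->
  char_height p (principal_block G M) i = logn p (char_deg i).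
Proof.
case=> [[_ M0 _ _] _ _]; rewrite /char_height.
suffices -> : block_defect p (principal_block G M) = logn p #|G|.
  by rewrite addnK.
apply/eqP; rewrite eqn_leq; apply/andP; split.
  by apply/bigmax_leqP=> j _; apply: leq_subr.
have B0 : 0 \in principal_block G M.
  by rewrite inE; apply/forallP=> k; rewrite subrr.
apply: leq_trans (leq_bigmax_cond _ B0).
have /eqP-> : char_deg (0 : Iirr G) == 1%N.
  by rewrite -char_deg_lin irr0 cfun1_lin_char.
by rewrite logn1 subn0.
Qed.

End CharacterTheory.

(** * Counting by height and the final bounds *)

Lemma sum_k_height_rv (gT : finGroupType) (G : {group gT}) (p m : nat)
    (B : {set Iirr G}) :
  \sum_(0 <= h < m) k_height_rv p h B
    = #|[set i in B | cfReal ('chi_i)%R && (char_height p B i < m)]|.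
Proof.
elim: m => [|m IHm].
  rewrite big_geq //; apply/esym/eqP; rewrite cards_eq0.
  by apply/eqP/setP=> i; rewrite !inE !andbF.
rewrite big_nat_recr //= IHm -[RHS](cardsID [set i | char_height p B i < m]).
congr (_ + _); apply: eq_card => i; rewrite !inE.
  by have [lt_m|] := ltnP _ m; rewrite ?andbF // ltnS ltnW ?andbT.
rewrite -leqNgt ltnS eqn_leq.
by case: (i \in B); case: cfReal; rewrite /= ?andbF // andbC.
Qed.

Lemma card_real_elts_isog (aT rT : finGroupType)
    (A : {group aT}) (B : {group rT}) :
  A \isog B -> #|real_elts A A| = #|real_elts B B|.
Proof.
have leq_isog (xT yT : finGroupType) (C : {group xT}) (E : {group yT}) :
  C \isog E -> #|real_elts C C| <= #|real_elts E E|.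
  case/isogP=> f inj_f <-.
  have sRC : real_elts C C \subset C by apply/subsetP=> x /setIdP[].
  rewrite -(card_injm inj_f sRC) subset_leq_card //.
  apply/subsetP=> _ /morphimP[x Cx /setIdP[_ realx] ->].
  by rewrite inE mem_morphim //= real_in_morphim.
by move=> isoAB; apply/eqP; rewrite eqn_leq !leq_isog // isog_sym.
Qed.

Lemma real_eltsS (gT : finGroupType) (A B C E : {set gT}) :
  A \subset B -> C \subset E -> #|real_elts A C| <= #|real_elts B E|.
Proof.
move=> sAB sCE; apply: subset_leq_card; apply/subsetP=> x.
by rewrite !inE => /andP[/(subsetP sAB)-> /(real_in_sub sCE)].
Qed.

Lemma card_real_elts_normal_Sylow2 (gT : finGroupType) (G Q : {group gT}) :
  Q <| G -> 2.-Sylow(G) Q -> #|real_elts G G| <= #|real_elts Q Q|.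
Proof.
move=> nsQG sylQ; apply: subset_leq_card; apply/subsetP=> x /setIdP[Gx realx].
by rewrite inE; apply/andP; apply: real_in_normal_Sylow2 realx.
Qed.


Lemma sum_k_height_rv_leq (gT : finGroupType) (G D : {group gT})
    (M : {pred algC}) (n : nat) :
    Aint_maximal_ideal M -> (2%:R)%R \in M ->
    2.-Sylow(G) D -> odd #|real_core G| ->
  \sum_(0 <= h < n.+1) k_height_rv 2 h (principal_block G M)
    <= #|real_elts (D / D^`(n.+1)) (D / D^`(n.+1))|.
Proof.
move=> maxM M2 sylD /odd_real_core_pcore oddW; rewrite sum_k_height_rv.
set N := ('O_2^'(G))%G; pose H := (G / N)%G; pose P := (D / N)%G.
have nsNG : N <| G := pcore_normal _ _; have [sNG nNG] := andP nsNG.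
have [sDG D2 _] := and3P sylD; have nND := subset_trans sDG nNG.
have sylP : 2.-Sylow(H) P by apply: quotient_pHall.
have nsPH : P <| H.
  have sylO : 2.-Sylow(H) 'O_2(H).
    rewrite /pHall pcore_sub pcore_pgroup -card_quotient ?gFnorm //=.
    by rewrite -odd_2'nat.
  by rewrite (eq_Hall_pcore sylO sylP) pcore_normal.
pose K := (coset N @*^-1 (P^`(n.+1)))%G.
have KE : K :=: N * D^`(n.+1).
  by rewrite /= -quotient_der // quotientK // (subset_trans (der_sub _ _)).
have KNE : K / N = P^`(n.+1) by rewrite cosetpreK.
have nsKG : K <| G.
  by rewrite -(quotientGK nsNG) cosetpre_normal; apply: gFnormal_trans.
have nKG := normal_norm nsKG; have nKD := subset_trans sDG nKG.
have sNK : N \subset K by rewrite KE mulG_subl.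
(* Dedekind's law, with [N] and [D] of coprime orders. The equality is between group records because
   the type of [D / L] depends on [L]. *)
have defKD : (D^`(n.+1))%G = (K :&: D)%G.
  apply/val_inj => /=; rewrite [coset N @*^-1 _]KE setIC -group_modr ?der_sub //.
  rewrite coprime_TIg ?mul1g //.
  exact: pnat_coprime D2 (pcore_pgroup _ _).
pose Q := (D / K)%G.
have sylQ : 2.-Sylow(G / K) Q by apply: quotient_pHall.
have nsQG : Q <| G / K.
  have -> : Q :=: (N * D) / K.
    by rewrite quotientMl ?(subset_trans sNG) // (quotientS1 sNK) mul1g.
  by rewrite -quotientK // quotient_normal // -(quotientGK nsNG) cosetpre_normal.
have isoDQ : D / D^`(n.+1) \isog Q.
  have isoDK L : L = (K :&: D)%G -> D / L \isog D / K.
    by move=> ->; apply: second_isog.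
  exact: isoDK defKD.
rewrite (card_real_elts_isog isoDQ).
apply: leq_trans (card_real_elts_normal_Sylow2 nsQG sylQ).
apply: leq_trans (card_cfReal_leq _).
set S := [set i in _ | _].
have kerK i : i \in S -> K \subset cfker ('chi_i)%R.
  case/setIdP=> B0i /andP[_].
  rewrite (principal_block_height _ _ maxM) ltnS => le_n.
  have kerN : N \subset cfker ('chi_i)%R by apply: principal_block_cfker B0i.
  rewrite -(quotientSGK (subset_trans (normal_sub nsKG) nNG) kerN) KNE.
  rewrite -cfker_quo // -quo_IirrE //.
  apply: normal_pgroup_der_cfker (pHall_pgroup sylP) _ _ => //.
  by rewrite /char_deg quo_IirrE // cfQuo1.
(* Passage to [G / K] is injective on [S], since inflation recovers the character. *)
rewrite -(card_in_imset (f := @quo_Iirr _ G K) (D := mem S))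
  => [|i j Si Sj eq_ij].
  apply: subset_leq_card; apply/subsetP=> _ /imsetP[i Si ->].
  rewrite inE quo_IirrE ?kerK // /cfReal cfAutQuo.
  by case/setIdP: Si => _ /andP[/eqP-> _].
by rewrite -(quo_IirrK nsKG (kerK i Si)) -(quo_IirrK nsKG (kerK j Sj)) eq_ij.
Qed.

Lemma k_rv_leq (gT : finGroupType) (G D : {group gT}) (M : {pred algC}) :
    Aint_maximal_ideal M -> (2%:R)%R \in M ->
    2.-Sylow(G) D -> odd #|real_core G| ->
  k_rv (principal_block G M) <= #|real_elts D D|.
Proof.
move=> maxM M2 sylD oddR.
have /derivedP[m Dm1] := pgroup_sol (pHall_pgroup sylD).
pose n := m + #|G|.
have Dn1 : D^`(n.+1) = 1.
  rewrite /n -addnS; elim: _.+1 => [|k IHk]; first by rewrite addn0.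
  by rewrite addnS dergSn IHk comm1G.
have isoD : D \isog D / D^`(n.+1) by rewrite Dn1; apply: quotient1_isog.
rewrite (card_real_elts_isog isoD).
apply: leq_trans (sum_k_height_rv_leq n maxM M2 sylD oddR).
rewrite sum_k_height_rv; apply: subset_leq_card; apply/subsetP=> i.
rewrite !inE => /andP[-> ->]; rewrite (principal_block_height _ _ maxM) /= ltnS.
apply: leq_trans (leq_addl m _).
apply: leq_trans (dvdn_leq (cardG_gt0 G) (dvdn_char_deg i)).
by rewrite ltnW // ltn_logl // char_deg_gt0.
Qed.

Theorem theorem20 (gT : finGroupType) (G D : {group gT}) (M : {pred algC})
    (maxM : Aint_maximal_ideal M) (M2 : (2%:R)%R \in M)
    (sylD : D \in 'Syl_2(G)) :
  let B0 := principal_block G M in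
  let bound (N : {group gT}) (n : nat) :=
    \sum_(0 <= i < n.+1) k_height_rv 2 i B0
      <= #|real_elts (D / D^`(n.+1)) (N / D^`(n.+1))| in
  [/\ odd #|real_core G| ->
        [/\ forall n, bound 'N_G(D)%G n,
            k_height_rv 2 0 B0 <= #|real_elts (D / D^`(1)) ('N_G(D) / D^`(1))|,
            k_rv B0 <= #|real_elts D 'N_G(D)|
          & k_rv B0 <= #|real_elts D G|],
      [\/ p_nilpotent 2 G^`(1)%G,
          'O_{2^', 2, 2^'}(G) = G
        | solvable G /\ (forall P : {group gT}, P \in 'Syl_2(G) -> abelian P)] ->
        forall n, bound 'N_G(D)%G n,
      'O_{2^', 2, 2^'}(G) = G <-> odd #|real_core G|
    & [\/ odd #|real_core G|,
          p_nilpotent 2 G^`(1)%G,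
          'O_{2^', 2, 2^'}(G) = G
        | solvable G /\ (forall P : {group gT}, P \in 'Syl_2(G) -> abelian P)] ->
        forall n, bound D n].
Proof.
move=> B0 bound; have sylD2 : 2.-Sylow(G) D by rewrite inE in sylD.
have sDG := pHall_sub sylD2.
have sDN : D \subset 'N_G(D) by rewrite subsetI sDG normG.
have boundD n : odd #|real_core G| -> bound D n by apply: sum_k_height_rv_leq.
(* Enlarging the group of inverting elements from [D] to its normaliser can only increase the
   count. *)
have boundN n : odd #|real_core G| -> bound 'N_G(D)%G n.
  move=> oddR; apply: leq_trans (boundD n oddR) _.
  by rewrite real_eltsS ?quotientS.
have oddRP : 'O_{2^', 2, 2^'}(G) = G <-> odd #|real_core G|.
  exact: iff_trans (pseries2_odd_quotient G) (iff_sym (odd_real_core_pcore G)).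
have oddR_ab : solvable G ->
    (forall P : {group gT}, P \in 'Syl_2(G) -> abelian P) ->
    odd #|real_core G|.
  move=> solG abS; apply/odd_real_core_pcore.
  by apply: abelian_Sylow2_odd_quotient sylD2 (abS D sylD).
have oddR_nil := @p_nilpotent_der_odd_real_core _ G.
split=> //.
- move=> oddR; split=> [n|||]; first exact: boundN.
  + by have := boundN 0 oddR; rewrite /bound big_nat1.
  + by apply: leq_trans (k_rv_leq maxM M2 sylD2 oddR) _; rewrite real_eltsS.
  + by apply: leq_trans (k_rv_leq maxM M2 sylD2 oddR) _; rewrite real_eltsS.
- by case=> [/oddR_nil|/oddRP|[solG /(oddR_ab solG)]] oddR n; apply: boundN.
- by case=> [|/oddR_nil|/oddRP|[solG /(oddR_ab solG)]] oddR n; apply: boundD.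
Qed.
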